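(* Irreducible nonequivalent $*$-representations of $\mathcal P_{2,com}$ generate all nonisomorphic transitive systems of two subspaces of a Hilbert space. Precisely: the system $(H;P_1H,P_2H)$ generated by any irreducible $*$-representation of $\mathcal P_{2,com}$ is transitive; nonequivalent irreducible $*$-representations generate nonisomorphic systems; and every transitive system $(H;H_1,H_2)$ of two subspaces of a (finite or infinite dimensional) Hilbert space $H$ is isomorphic to the system generated by some irreducible $*$-representation of $\mathcal P_{2,com}$.
   Context: All Hilbert spaces are complex and nonzero; subspaces are closed; $B(H)$ denotes the bounded linear operators on $H$. A system of $n$ subspaces is a tuple $S=(H;H_1,\ldots,H_n)$, where $H$ is a Hilbert space and $H_1,\ldots,H_n$ are subspaces of $H$. Two systems $S=(H;H_1,\ldots,H_n)$ and $\tilde S=(\tilde H;\tilde H_1,\ldots,\tilde H_n)$ are isomorphic if there is a bounded linear bijection $R:H\to\tilde H$ with $R(H_i)=\tilde H_i$ for all $i=1,\ldots,n$. Put $\mathrm{End}(S)=\{R\in B(H): R(H_i)\subset H_i,\ i=1,\ldots,n\}$. The system $S$ is transitive if $\mathrm{End}(S)=\mathbb C I_H$. $\mathcal P_{n,com}$ is the unital $*$-algebra generated by $p_1,\ldots,p_n$ with relations $p_k^2=p_k^*=p_k$ and $[\sum_{k=1}^n p_k,p_i]=0$ for all $i=1,\ldots,n$. A $*$-representation of $\mathcal P_{n,com}$ on a Hilbert space $H$ is a tuple $(P_1,\ldots,P_n)$ of orthogonal projections on $H$ such that $\sum_k P_k$ commutes with every $P_i$. It is irreducible if $P_1,\ldots,P_n$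 have no common invariant closed subspaces other than $0$ and $H$. Representations $(P_i)$ on $H$ and $(\tilde P_i)$ on $\tilde H$ are (unitarily) equivalent if there is a unitary operator $R:H\to\tilde H$ with $RP_i=\tilde P_iR$ for all $i$. The system generated by $(P_1,\ldots,P_n)$ is $(H;P_1H,\ldots,P_nH)$. *)

(* Defs.v *)
From HB Require Import structures.
From mathcomp Require Import all_boot all_order all_algebra.
From mathcomp Require Import sesquilinear complex.
From mathcomp Require Import all_classical all_reals topology normedtype.

Set Implicit Arguments.
Unset Strict Implicit.
Unset Printing Implicit Defensive.

Import Order.TTheory GRing.Theory Num.Theory.
Import numFieldNormedType.Exports.

Local Open Scope classical_set_scope.
Local Open Scope ring_scope.
Local Open Scope complex_scope.

(* A nonzero complex Hilbert space of arbitrary dimension.  The inner product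
   is linear in its first argument and conjugate-linear in the second. *)
HB.mixin Record isHilbert (R : realType) H of CompleteNormedModule R[i] H := {
  inner_subdef : {dot H for (@Num.conj R[i])};
  inner_norm_subproof : forall x : H, `|x| ^+ 2 = inner_subdef x x;
  hilbert_nonzero_subproof : exists x : H, x != 0
}.

#[short(type="hilbertType")]
HB.structure Definition Hilbert (R : realType) :=
  {H of isHilbert R H & CompleteNormedModule R[i] H}.

Definition inner (R : realType) (H : hilbertType R) : H -> H -> R[i] :=
  @inner_subdef R H.

Section Systems.
Variable R : realType.
Implicit Types H K : hilbertType R.

Definition linear_subspace H (V : set H) : Prop :=
  V 0 /\ forall (a : R[i]) (x y : H), V x -> V y -> V (a *: x + y).

Record subspace H := Subspace {
  subspace_set :> set H;
  subspace_linear : linear_subspace subspace_set;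
  subspace_closed : closed subspace_set
}.

Definition bounded_operator H K (T : {linear H -> K}) : Prop :=
  exists M : R[i], forall x : H, `|T x| <= M * `|x|.

Record bounded_op H K := BoundedOp {
  op_linear :> {linear H -> K};
  op_bounded : bounded_operator op_linear
}.

Definition adjoint H K (T : bounded_op H K) (S : bounded_op K H) : Prop :=
  forall (x : H) (y : K), inner (T x) y = inner x (S y).

Definition orthogonal_projection H (P : bounded_op H H) : Prop :=
  (forall x : H, P (P x) = P x) /\ adjoint P P.

Definition unitary H K (U : bounded_op H K) : Prop :=
  bijective U /\ forall x y : H, inner (U x) (U y) = inner x y.

Record system n := System {
  system_space :> hilbertType R;
  system_sub : 'I_n -> subspace system_space
}.

Definition isomorphic n (S S' : system n) : Prop :=
  exists T : bounded_op S S',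
    bijective T /\ forall i : 'I_n, T @` system_sub S i = system_sub S' i.

Definition endomorphisms n (S : system n) : set (bounded_op S S) :=
  [set T : bounded_op S S |
    forall i : 'I_n, T @` system_sub S i `<=` system_sub S i].
Arguments endomorphisms {n} S _.

Definition transitive_system n (S : system n) : Prop :=
  endomorphisms S =
    [set T : bounded_op S S | exists c : R[i], forall x : S, T x = c *: x].

(* A *-representation of P_{n,com} is given by the images of the generators. *)
Record com_rep n := ComRep {
  rep_space :> hilbertType R;
  rep_proj : 'I_n -> bounded_op rep_space rep_space;
  rep_projP : forall i : 'I_n, orthogonal_projection (rep_proj i);
  rep_comm : forall (i : 'I_n) (x : rep_space),
    \sum_(k < n) rep_proj k (rep_proj i x) =
    rep_proj i (\sum_(k < n) rep_proj k x)
}.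

Definition irreducible n (P : com_rep n) : Prop :=
  forall V : subspace P,
    (forall i : 'I_n, rep_proj P i @` V `<=` V) ->
    (V : set P) = [set 0] \/ (V : set P) = setT.

Definition equivalent n (P Q : com_rep n) : Prop :=
  exists U : bounded_op P Q,
    unitary U /\
    forall (i : 'I_n) (x : P), U (rep_proj P i x) = rep_proj Q i (U x).

Lemma bounded_op_continuous H K (T : bounded_op H K) : continuous T.
Proof.
case: T => T [M TM]; apply: bounded_linear_continuous.
apply/linear_boundedP => /=.
have [x x0] := @hilbert_nonzero_subproof R H.
have nx : 0 < `|x| by rewrite normr_gt0.
have M0 : 0 <= M.
  by rewrite -(pmulr_lge0 _ nx); apply: le_trans (TM x); exact: normr_ge0.
exists M; split; first exact: ger0_real.
move=> r Mr y; apply: (le_trans (TM y)).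
by apply: ler_wpM2r; [exact: normr_ge0 | exact: ltW].
Qed.

Lemma projection_range_linear H (P : bounded_op H H) :
  linear_subspace (range P).
Proof.
split; first by exists 0 => //; rewrite linear0.
move=> a _ _ [x _ <-] [y _ <-].
by exists (a *: x + y) => //; rewrite linearP.
Qed.

Lemma projection_range_closed H (P : bounded_op H H) :
  orthogonal_projection P -> closed (range P).
Proof.
move=> [PP _].
have -> : range P = (fun x => P x - x) @^-1` [set 0].
  apply/seteqP; split=> [_ [x _ <-]|x /= /eqP].
    by rewrite /= PP subrr.
  by rewrite subr_eq0 => /eqP Px; exists x.
apply: preimage_closed => [x _|].
  by apply: cvgB; [exact: bounded_op_continuous | exact: cvg_id].
exact/accessible_closed_set1/hausdorff_accessible/norm_hausdorff.
Qed.

Definition projection_range H (P : bounded_op H H)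
    (hP : orthogonal_projection P) : subspace H :=
  Subspace (projection_range_linear P) (projection_range_closed hP).

Definition generated_system n (P : com_rep n) : system n :=
  System (fun i : 'I_n => projection_range (@rep_projP n P i)).

End Systems.

(* Main.v *)
(** Two projections in a representation of P_{2,com} commute with each other,
    since each commutes with their sum.  In an irreducible representation their
    ranges are invariant, so both projections are 0 or 1 and the space is a
    line; on a line everything is determined by which projections vanish.

    Conversely, in a transitive system (H; H_0, H_1) it suffices to find nonzero
    u and v such that each H_i contains u or is orthogonal to v: then
    x |-> <x, v> u is an endomorphism, hence a nonzero scalar, and H = C u.
    When H_0 <> 0 and H_1 <> H take u in H_0 and v orthogonal to H_1; in the
    other cases u = v will do. *)

Require Import Defs.
From HB Require Import structures.
From mathcomp Require Import all_boot all_order all_algebra.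
From mathcomp Require Import sesquilinear complex.
From mathcomp Require Import all_classical all_reals topology normedtype.
From mathcomp Require Import ring interval_inference.

Set Implicit Arguments.
Unset Strict Implicit.
Unset Printing Implicit Defensive.

Import Order.TTheory GRing.Theory Num.Theory.
Import numFieldNormedType.Exports.

Local Open Scope classical_set_scope.
Local Open Scope ring_scope.
Local Open Scope complex_scope.

(** * Inner product identities and the Cauchy-Schwarz inequality *)

HB.instance Definition _ (R : realType) (H : hilbertType R) :=
  Dot.copy (@inner R H) (@inner_subdef R H).

Section Hilbert.
Variables (R : realType) (H : hilbertType R).
Implicit Types (x y z u v w : H) (a b c : R[i]).

Lemma innerxx x : inner x x = `|x| ^+ 2.
Proof. by rewrite inner_norm_subproof. Qed.

Lemma innerC x y : inner x y = (inner y x)^*%R.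
Proof. by rewrite (hermC (@inner R H)) expr0 mul1r. Qed.

Lemma innerZl a x y : inner (a *: x) y = a * inner x y.
Proof. by rewrite linearZl_LR. Qed.

Lemma innerZr a x y : inner x (a *: y) = a^*%R * inner x y.
Proof. by rewrite linearZr_LR. Qed.

Lemma innerBl x y z : inner (x - y) z = inner x z - inner y z.
Proof. by rewrite linearBl. Qed.

Lemma linear_subspaceZ (V : set H) a x :
  linear_subspace V -> V x -> V (a *: x).
Proof. by move=> [V0 VP] Vx; rewrite -[_ *: _]addr0; apply: VP. Qed.

(** Pythagoras: the subtracted vector is the orthogonal projection of [z] onto the line through
    [w]. *)
Lemma sqr_norm_sub_proj z w : w != 0 ->
  `|z - (inner z w / `|w| ^+ 2) *: w| ^+ 2 =
  `|z| ^+ 2 - `|inner z w| ^+ 2 / `|w| ^+ 2.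
Proof.
move=> w0; have nw : `|w| ^+ 2 != 0 by rewrite expf_neq0 // normr_eq0.
have cn : (`|w| ^+ 2)^*%R = `|w| ^+ 2 by rewrite conj_Creal // rpredX // normr_real.
rewrite -!innerxx !(linearBl, linearBr) /= !innerZl !innerZr !innerxx.
rewrite rmorphM /= fmorphV /= cn (innerC w z) normCK.
(* [inner z w] and its conjugate become independent variables, leaving a rational identity. *)
move: nw; move: (`|w| ^+ 2) (inner z w) (`|z| ^+ 2) => m b c m0; move: b^*%R => b'.
by field.
Qed.

Lemma cauchy_schwarz z w : `|inner z w| <= `|z| * `|w|.
Proof.
have [->|w0] := eqVneq w 0; first by rewrite linear0r normr0 mulr_ge0.
rewrite -ler_sqr ?nnegrE ?mulr_ge0 // exprMn -ler_pdivrMr ?exprn_gt0 ?normr_gt0 //.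
by rewrite -subr_ge0 -sqr_norm_sub_proj // exprn_ge0.
Qed.

(** * Orthogonal projection onto a closed subspace *)

Lemma approximate_minimizer (V : set H) x (e : R) :
  linear_subspace V -> 0 < e ->
  exists2 y, V y & forall z, V z -> `|x - y| ^+ 2 <= `|x - z| ^+ 2 + e%:C.
Proof.
(* Norms live in [R[i]], so the infimum is taken over real parts. *)
move=> [V0 VP] e0; pose q y := complex.Re (`|x - y| ^+ 2).
have qE y : (q y)%:C = `|x - y| ^+ 2 by rewrite RRe_real // rpredX // normr_real.
have lb : lbound (q @` V) 0 by move=> _ [y _ <-]; rewrite -ler0c qE exprn_ge0.
have [] := @inf_adherent _ (q @` V) e e0.
  by split; [exists (q 0), 0 | exists 0].
move=> _ [y Vy <-] yD; exists y => // z Vz; rewrite -!qE -rmorphD lecR.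
apply/ltW/(lt_le_trans yD); rewrite lerD2r.
by apply: ge_inf; [exists 0 | exists z].
Qed.

(* Minimality of y compared with y + t w, t = <x - y, w> / |w|^2. *)
Lemma almost_orthogonal (V : set H) x (e : R) :
  linear_subspace V -> 0 < e ->
  exists2 y, V y & forall w, V w -> `|inner (x - y) w| <= e%:C * `|w|.
Proof.
(* The tolerance is [e ^+ 2] because the inner product enters the comparison squared. *)
move=> Vlin e0; have [y Vy ymin] := approximate_minimizer x Vlin (exprn_gt0 2 e0).
exists y => // w Vw.
have [->|w0] := eqVneq w 0; first by rewrite linear0r !normr0 mulr0.
have ec : 0 <= e%:C by rewrite ler0c ltW.
rewrite -ler_sqr ?nnegrE ?mulr_ge0 // exprMn -ler_pdivrMr ?exprn_gt0 ?normr_gt0 //.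
set t := inner (x - y) w / `|w| ^+ 2.
have := ymin (t *: w + y); case: Vlin => _ VP /(_ (VP _ _ _ Vw Vy)).
rewrite opprD addrA addrAC sqr_norm_sub_proj // rmorphXn /=.
by rewrite -addrA lerDl addrC subr_ge0.
Qed.

(** Almost orthogonal approximants with tolerance 1/(n+1) form a Cauchy sequence. Its limit lies in
    [V] by closedness, and Cauchy-Schwarz carries orthogonality over to the limit. *)
Lemma orthogonal_decomposition (V : set H) x :
  linear_subspace V -> closed V ->
  exists2 y, V y & forall w, V w -> inner (x - y) w = 0.
Proof.
move=> Vlin Vcl; have e_gt0 n : 0 < n.+1%:R^-1 :> R by rewrite invr_gt0 ltr0n.
pose e n : R[i] := (n.+1%:R^-1)%:C.
have /choice[y yP] : forall n, exists y, V y /\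
    forall w, V w -> `|inner (x - y) w| <= e n * `|w|.
  by move=> n; have [y ? ?] := almost_orthogonal x Vlin (e_gt0 n); exists y.
have e_lt (d : R[i]) : 0 < d -> \forall n \near \oo, e n < d.
  case: d => a b; rewrite ltcE /= => /andP[/eqP -> /posnumP[a']].
  have [N _ HN] := near_infty_natSinv_lt a'.
  by exists N => // n /HN; rewrite ltcR.
have Vsub u v : V u -> V v -> V (u - v).
  case: Vlin => _ VP Vu Vv.
  by rewrite addrC -scaleN1r; apply: VP.
(* With d = y m - y n in V, |d|^2 = <x - y n, d> - <x - y m, d>. *)
have dist m n : `|y m - y n| <= e m + e n.
  have [Vm Pm] := yP m; have [Vn Pn] := yP n.
  have [->|] := eqVneq (y m - y n) 0.
    by rewrite normr0 addr_ge0 // ler0c ltW.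
  rewrite -normr_gt0 => d0; rewrite -(ler_pM2r d0) -expr2 mulrDl.
  have Vd := Vsub _ _ Vm Vn.
  have -> : `|y m - y n| ^+ 2 = `|inner (x - y n) (y m - y n) -
                                  inner (x - y m) (y m - y n)|.
    have E : x - y n - (x - y m) = y m - y n.
      by rewrite opprB [LHS]addrC addrA subrK.
    by rewrite -innerBl E innerxx normrX normr_id.
  by rewrite [leRHS]addrC (le_trans (ler_normB _ _)) // lerD ?Pm ?Pn.
have half (d : R[i]) : 0 < d -> 0 < d / 2 by move=> d0; rewrite divr_gt0.
have /cauchy_cvg ycvg : cauchy (y @ \oo).
  apply: cauchy_exP => d /half d0; have [N _ HN] := e_lt _ d0.
  exists (y N); exists N => // n /= Nn; rewrite -ball_normE /=.
  rewrite (le_lt_trans (dist N n)) // [d]splitr.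
  exact: ltrD (HN _ (leqnn N)) (HN _ Nn).
have Vlim : V (lim (y @ \oo)).
  apply: (closed_cvg _ Vcl _ _ ycvg).
  by apply: nearW => n; case: (yP n).
exists (lim (y @ \oo)) => // w Vw.
apply/eqP; rewrite -normr_eq0 -normr_le0; apply/ler_addgt0Pr => d d0.
rewrite add0r.
(* Each of the two errors below is at most half of d |w| / (1 + |w|), which is less than d; the
   added 1 covers w = 0. *)
have w1 : 0 < 1 + `|w| by rewrite ltr_pwDl.
have dw : 0 < d / (1 + `|w|) / 2 by rewrite half // divr_gt0.
near \oo => n.
have -> : inner (x - lim (y @ \oo)) w =
    inner (x - y n) w + inner (y n - lim (y @ \oo)) w.
  by rewrite -linearDl /= addrA subrK.
have [_ /(_ _ Vw) Pn] := yP n.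
have en : e n <= d / (1 + `|w|) / 2 by apply/ltW; near: n; exact: e_lt.
have yn : `|y n - lim (y @ \oo)| <= d / (1 + `|w|) / 2.
  by rewrite distrC; near: n; move/cvgrPdist_le: ycvg; exact.
rewrite normr_id; apply: (le_trans (ler_normD _ _)).
apply: (@le_trans _ _ (d / (1 + `|w|) * `|w|)).
  rewrite [X in X * _]splitr mulrDl lerD //.
    by apply: (le_trans Pn); rewrite ler_wpM2r.
  by apply: (le_trans (cauchy_schwarz _ _)); rewrite ler_wpM2r.
by rewrite mulrAC ler_pdivrMr // ler_pM2l // lerDr.
Unshelve. all: by end_near. Qed.

(** * Lines and rank-one operators *)

Definition spanned_by u := forall x, exists c, x = c *: u.

Lemma spanned_by_nonzero u v : spanned_by u -> v != 0 -> spanned_by v.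
Proof.
move=> su v0 x; have [a va] := su v; have [b ->] := su x.
have a0 : a != 0 by apply: contraNneq v0 => a0; rewrite va a0 scale0r.
by exists (b / a); rewrite va scalerA divfK.
Qed.

Section RankOne.
Variables u v : H.

Definition rank_one x : H := inner x v *: u.

Fact rank_one_linear : linear rank_one.
Proof. by move=> a x y; rewrite /rank_one linearPl scalerDl scalerA. Qed.

HB.instance Definition _ := GRing.isLinear.Build R[i] H H *:%R rank_one rank_one_linear.

Fact rank_one_bounded : bounded_operator rank_one.
Proof.
exists (`|v| * `|u|) => x; rewrite /rank_one normrZ.
by rewrite mulrAC ler_wpM2r // mulrC cauchy_schwarz.
Qed.

Definition rank_one_op : bounded_op H H := BoundedOp rank_one_bounded.

(** Evaluation at [v] shows that [c] is nonzero; dividing by [c] then writes every [x] as a multiple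
    of [u]. *)
Lemma scalar_rank_one c : u != 0 -> v != 0 ->
  (forall x, rank_one_op x = c *: x) -> spanned_by u.
Proof.
rewrite /= /rank_one => u0 v0 Tc x.
have c0 : c != 0.
  apply: contraNneq v0 => c0; have /eqP := Tc v.
  by rewrite c0 scale0r scaler_eq0 (negPf u0) orbF innerxx expf_eq0 normr_eq0.
by exists (inner x v / c); rewrite mulrC -scalerA Tc scalerA mulVf // scale1r.
Qed.

End RankOne.

Lemma linear_subspace_line u : linear_subspace (range (fun a => a *: u)).
Proof.
split; first by exists 0; rewrite ?scale0r.
move=> a _ _ [b _ <-] [c _ <-]; exists (a * b + c) => //.
by rewrite scalerDl scalerA.
Qed.

(** The line is the range of the orthogonal projection x |-> <x, u> u / <u, u>. *)
Lemma closed_line u : u != 0 -> closed (range (fun a => a *: u)).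
Proof.
move=> u0; have uu : inner u u != 0 by rewrite innerxx expf_neq0 // normr_eq0.
pose k := (inner u u)^-1.
have kJ : k^*%R = k by rewrite fmorphV /= -innerC.
pose P := rank_one_op u (k *: u).
have projP : orthogonal_projection P.
  split=> [x|x y]; rewrite /= /rank_one !innerZl !innerZr kJ.
    by rewrite mulVf // mulr1.
  by rewrite rmorphM /= kJ -innerC mulrAC.
have <- : range P = range (fun a => a *: u).
  apply/seteqP; split=> [_ [x _ <-]|_ [a _ <-]].
    by exists (inner x (k *: u)).
  exists (a *: u) => //=.
  by rewrite /rank_one innerZl innerZr kJ mulVf // mulr1.
exact: projection_range_closed.
Qed.

Lemma scale_bounded c : bounded_operator ( *:%R c : {linear H -> H}).
Proof. by exists `|c| => x; rewrite /= normrZ. Qed.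

Definition scale_op c : bounded_op H H := BoundedOp (scale_bounded c).

End Hilbert.

Lemma scaled_bounded (R : realType) (H K : hilbertType R) (c : R[i])
    (T : bounded_op H K) : bounded_operator (c \*: T : {linear H -> K}).
Proof.
case: T => T [M TM]; exists (`|c| * M) => x /=.
by rewrite normrZ -mulrA ler_wpM2l.
Qed.

Lemma ord2_cases (i : 'I_2) : i = ord0 \/ i = ord_max.
Proof. by case: i => [[|[|//]] ?]; [left|right]; apply: val_inj. Qed.

(** * Irreducible representations of P_{2,com} *)

Section Representations.
Variable R : realType.
Implicit Types P Q : com_rep R 2.

(** In the relation for index 0 the term P_0 P_0 x occurs on both sides; cancelling it leaves P_1
    P_0 x = P_0 P_1 x. *)
Lemma rep_proj_commute P i j (x : P) :
  rep_proj P i (rep_proj P j x) = rep_proj P j (rep_proj P i x).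
Proof.
have PC : rep_proj P ord_max (rep_proj P ord0 x) =
          rep_proj P ord0 (rep_proj P ord_max x).
  have := @rep_comm _ _ P ord0 x; rewrite linear_sum !big_ord_recl !big_ord0 !addr0.
  by move/addrI; have -> : lift ord0 ord0 = ord_max :> 'I_2 by exact: val_inj.
by case: (ord2_cases i) => ->; case: (ord2_cases j) => ->.
Qed.

Lemma irreducible_rep_proj P i : irreducible P ->
  (forall x, rep_proj P i x = 0) \/ (forall x, rep_proj P i x = x).
Proof.
move=> irrP; have projP := @rep_projP _ _ P i.
case: (irrP (projection_range projP)) => [j|rangeE|rangeE].
- move=> _ [_ [x _ <-] <-]; exists (rep_proj P j x) => //.
  exact: rep_proj_commute.
- left=> x; have : range (rep_proj P i) (rep_proj P i x) by exists x.
  by rewrite -[range _]/(projection_range projP : set P) rangeE.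
- right=> x; have : (projection_range projP : set P) x by rewrite rangeE.
  by case=> y _ <-; have [PP _] := projP.
Qed.

(** Both projections are scalars, so the line through [u] is invariant and must be the whole
    space. *)
Lemma irreducible_spanned P (u : P) : irreducible P -> u != 0 -> spanned_by u.
Proof.
move=> irrP u0.
pose V := Subspace (linear_subspace_line u) (closed_line u0).
have Vu : (V : set P) u by exists 1; rewrite ?scale1r.
case: (irrP V) => [i|VE|VE].
- case: (irreducible_rep_proj i irrP) => PE _ [_ [a _ <-] <-].
    by exists 0; rewrite ?scale0r // PE.
  by exists a; rewrite // PE.
- by move: Vu; rewrite VE => /eqP; rewrite (negPf u0).
- by move=> x; have : (V : set P) x; [rewrite VE | case=> a _ <-; exists a].
Qed.

Lemma spanned_irreducible P (u : P) : spanned_by u -> irreducible P.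
Proof.
move=> su V _.
have [[v Vv /eqP v0]|V0] := pselect (exists2 v, (V : set P) v & v <> 0).
  right; apply/seteqP; split=> // x _.
  have [a ->] := spanned_by_nonzero su v0 x.
  exact: (linear_subspaceZ _ (subspace_linear V)).
left; apply/seteqP; split=> [x Vx|_ ->]; last by case: (subspace_linear V).
by apply: contrapT => x0; apply: V0; exists x.
Qed.

Lemma spanned_transitive n (S : system R n) (u : S) :
  spanned_by u -> transitive_system S.
Proof.
move=> su; apply/seteqP; split=> [T _|T [c Tc] i].
  have [c Tu] := su (T u); exists c => x; have [a ->] := su x.
  by rewrite linearZ /= Tu !scalerA mulrC.
move=> _ [x Vx <-]; rewrite Tc.
exact: (linear_subspaceZ _ (subspace_linear (system_sub S i))).
Qed.

Lemma irreducible_transitive P :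
  irreducible P -> transitive_system (generated_system P).
Proof.
move=> irrP; have [u u0] := @hilbert_nonzero_subproof R P.
exact: (@spanned_transitive _ (generated_system P) u (irreducible_spanned irrP u0)).
Qed.

(** An isomorphism between lines is a multiple of a unitary, and it preserves which of the subspaces
    vanish. *)
Lemma isomorphic_equivalent P Q : irreducible P -> irreducible Q ->
  isomorphic (generated_system P) (generated_system Q) -> equivalent P Q.
Proof.
move=> irrP irrQ [T [Tbij Tsub]].
have [u u0] := @hilbert_nonzero_subproof R P.
have su := irreducible_spanned irrP u0.
have Tu0 : T u != 0 by rewrite -(linear0 T) (inj_eq (bij_inj Tbij)).
(* This factor makes [c \*: T] preserve the norm of [u], hence all inner products on the line. *)
pose c := `|u| / `|T u|.
have c0 : c != 0 by rewrite mulf_neq0 ?invr_eq0 ?normr_eq0.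
exists (BoundedOp (scaled_bounded c T)); split; first split.
- apply: bij_comp Tbij.
  by exists ( *:%R c^-1) => x; rewrite scalerA ?mulVf ?mulfV ?scale1r.
- move=> x y; have [a ->] := su x; have [b ->] := su y.
  rewrite /= !linearZ /= !scalerA !innerZl !innerZr !innerxx.
  have cJ : c^*%R = c by rewrite conj_Creal // rpred_div // normr_real.
  have cc : c ^+ 2 * `|T u| ^+ 2 = `|u| ^+ 2.
    by rewrite -exprMn divfK // normr_eq0.
  by rewrite rmorphM /= cJ -cc; ring.
move=> i x /=; have /= TP := Tsub i.
(* If one projection is 0 and the other 1, the matching of ranges under [T] forces T x = 0. *)
have [PE|PE] := irreducible_rep_proj i irrP;
  have [QE|QE] := irreducible_rep_proj i irrQ; rewrite PE QE ?linear0 ?scaler0 //.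
  have : range (rep_proj Q i) (T x) by exists (T x).
  by rewrite -TP => -[_ [z _ <-] <-]; rewrite PE linear0 scaler0.
have : [set T y | y in range (rep_proj P i)] (T x).
  by exists x => //; exists x.
by rewrite TP => -[z _ <-]; rewrite QE scaler0.
Qed.

(** * Transitive systems of two subspaces *)

Lemma transitive_spanned (S : system R 2) :
  transitive_system S -> exists u : S, spanned_by u.
Proof.
move=> trS.
have key (u v : S) : u != 0 -> v != 0 ->
    (forall i, (system_sub S i : set S) u \/
               (forall x, (system_sub S i : set S) x -> inner x v = 0)) ->
    exists u : S, spanned_by u.
  move=> u0 v0 uv; exists u.
  (* On each subspace the operator either vanishes or takes values in a line inside that
     subspace. *)
  have : endomorphisms (rank_one_op u v).
    move=> i _ [x Vx <-] /=; rewrite /rank_one.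
    have [Vu|->//] := uv i.
      exact: (linear_subspaceZ _ (subspace_linear (system_sub S i))).
    by rewrite scale0r; case: (subspace_linear (system_sub S i)).
  by rewrite trS => -[c]; exact: scalar_rank_one.
have [w w0] := @hilbert_nonzero_subproof R S.
have [[u V0u /eqP u0]|V0_0] :=
    pselect (exists2 u, (system_sub S ord0 : set S) u & u <> 0).
  have [V1T|/existsNP[x V1x]] := pselect (forall x, (system_sub S ord_max : set S) x).
    by apply: (key u u) => // i; left; case: (ord2_cases i) => ->.
  have [y V1y yP] :=
    orthogonal_decomposition x (subspace_linear (system_sub S ord_max))
      (@subspace_closed _ _ (system_sub S ord_max)).
  (* Since [x] lies outside H_1, its component [x - y] orthogonal to H_1 is nonzero. *)
  apply: (key u (x - y)) => // [|i].
    by rewrite subr_eq0; apply: contra_notN V1x => /eqP ->.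
  case: (ord2_cases i) => ->; [by left | right=> z /yP zP].
  by rewrite innerC zP rmorph0.
have V0 z : (system_sub S ord0 : set S) z -> z = 0.
  by move=> Vz; apply: contrapT => z0; apply: V0_0; exists z.
have [[u V1u /eqP u0]|V1_0] :=
    pselect (exists2 u, (system_sub S ord_max : set S) u & u <> 0).
  apply: (key u u) => // i; case: (ord2_cases i) => ->; last by left.
  by right=> z /V0 ->; rewrite linear0l.
(* Both subspaces are zero here, so any nonzero vector is orthogonal to them. *)
apply: (key w w) => // i; right=> z Vz.
suff -> : z = 0 by rewrite linear0l.
case: (ord2_cases i) Vz => -> Vz; first exact: V0.
by apply: contrapT => z0; apply: V1_0; exists z.
Qed.

(** * A representation generating a given system on a line *)

Section SpannedSystem.
Variables (S : system R 2) (u : S).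
Hypothesis su : spanned_by u.

(* The projection onto the i-th subspace, which is 0 or the whole line. *)
Definition full_part i : bounded_op S S :=
  scale_op S (`[< forall x, (system_sub S i : set S) x >])%:R.

Fact full_part_proj i : orthogonal_projection (full_part i).
Proof.
rewrite /full_part; case: `[< _ >]; split=> [x|x y] /=.
- by rewrite !scale1r.
- by rewrite !scale1r.
- by rewrite !scale0r.
- by rewrite !scale0r linear0l linear0r.
Qed.

Fact full_part_comm i x :
  \sum_(k < 2) full_part k (full_part i x) =
  full_part i (\sum_(k < 2) full_part k x).
Proof.
rewrite linear_sum; apply: eq_bigr => k _.
by rewrite /= !scalerA mulrC.
Qed.

Definition full_part_rep : com_rep R 2 := ComRep full_part_proj full_part_comm.

Lemma range_full_part i : range (full_part i) = system_sub S i.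
Proof.
have Vlin := subspace_linear (system_sub S i).
rewrite /full_part; case: asboolP => [VT|VnT] /=.
  by apply/seteqP; split=> // x _; exists x; rewrite ?scale1r.
apply/seteqP; split=> [_ [x _ <-]|x Vx]; first by rewrite scale0r; case: Vlin.
(* A nonzero [x] in the subspace would span the whole line, contradicting properness. *)
exists 0; rewrite // scaler0; apply: contrapT => /eqP; rewrite eq_sym => x0.
apply: VnT => y; have [a ->] := spanned_by_nonzero su x0 y.
exact: (linear_subspaceZ _ Vlin).
Qed.

Lemma isomorphic_full_part : isomorphic S (generated_system full_part_rep).
Proof.
exists (scale_op S 1); split.
  by exists id => x /=; rewrite scale1r.
move=> i; rewrite /= range_full_part -[RHS]image_id.
by apply: eq_imagel => x _ /=; rewrite scale1r.
Qed.

End SpannedSystem.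
End Representations.

Theorem proposition6 (R : realType) :
  (forall P : com_rep R 2,
      irreducible P -> transitive_system (generated_system P)) /\
  (forall P Q : com_rep R 2,
      irreducible P -> irreducible Q -> ~ equivalent P Q ->
      ~ isomorphic (generated_system P) (generated_system Q)) /\
  (forall S : system R 2,
      transitive_system S ->
      exists P : com_rep R 2,
        irreducible P /\ isomorphic S (generated_system P)).
Proof.
split; first exact: irreducible_transitive.
split=> [P Q irrP irrQ nPQ iPQ|S /transitive_spanned[u su]].
  exact/nPQ/isomorphic_equivalent.
exists (full_part_rep S); split; last exact: isomorphic_full_part su.
exact: (@spanned_irreducible _ (full_part_rep S) u).
Qed.
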